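(* Let $X$ be a two-dimensional real vector space endowed with a gauge $\gamma$ and a symplectic form $\omega$. Let $\gamma_\omega$ be the dual gauge of $\gamma$, let $\dashv$ be the orthogonality relation given by $\gamma$, and let $\dashv_\omega$ be the orthogonality relation given by $\gamma_\omega$. For all $x,y\in X$ with $\omega(y,x)>0$, if $x\dashv_\omega y$, then $-y\dashv x$.
   Context: A gauge on a finite-dimensional real vector space $X$ is a function $\gamma:X\to\mathbb{R}$ with $\gamma(x)\ge 0$ and equality iff $x=0$, $\gamma(\alpha x)=\alpha\gamma(x)$ for $\alpha\ge0$, and $\gamma(x+y)\le\gamma(x)+\gamma(y)$ (symmetry is not assumed). Its unit ball is $K=\{x:\gamma(x)\le1\}$. A symplectic form $\omega$ is a nondegenerate skew-symmetric bilinear form on $X$. It gives an isomorphism $\mathcal{I}:X^*\to X$ determined by $f(\cdot)=\omega(\mathcal{I}(f),\cdot)$. With $K^\circ=\{f\in X^*: f(x)\le1\ \forall x\in K\}$, the dual body is $K^\omega=\mathcal{I}(K^\circ)$, and the dual gauge $\gamma_\omega$ is the gauge with unit ball $K^\omega$, i.e. $\gamma_\omega(x)=\inf\{\lambda\ge0:x\in\lambda K^\omega\}$. For a gauge $\delta$ on $X$, $x$ is orthogonal to $y$ with respect to $\delta$ if $\delta(x)\le\delta(x+ty)$ for all $t\in\mathbb{R}$. *)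

(* Defs.v *)
From HB Require Import structures.
From mathcomp Require Import all_boot all_order all_algebra sesquilinear.
From mathcomp Require Import boolp classical_sets reals.

Set Implicit Arguments.
Unset Strict Implicit.
Unset Printing Implicit Defensive.

Import Order.TTheory GRing.Theory Num.Theory.
Local Open Scope classical_set_scope.
Local Open Scope ring_scope.

Section Gauges.
Variables (R : realType) (X : vectType R).
Implicit Types (g : X -> R) (C : set X).

Record is_gauge g : Prop := IsGauge {
  gauge_ge0 : forall x, 0 <= g x;
  gauge_eq0 : forall x, g x = 0 <-> x = 0;
  gaugeZ : forall (a : R) x, 0 <= a -> g (a *: x) = a * g x;
  gaugeD : forall x y, g (x + y) <= g x + g y }.

Definition unit_ball g : set X := [set x | g x <= 1].

(* [inf] is 0 by convention when no l qualifies, i.e. when C does not absorb x. *)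
Definition minkowski C (x : X) : R :=
  inf [set l : R | 0 <= l /\ ( *:%R l @` C) x].

Definition orthogonal_to g (x y : X) : Prop := forall t : R, g x <= g (x + t *: y).

(* The dual space of X is rendered as 'Hom(X, R^o). *)
Definition polar C : set 'Hom(X, R^o) :=
  [set f | forall x, C x -> (f x : R) <= 1].

End Gauges.

Section DualGauge.
Variables (R : realType) (X : vectType R) (omega : {skew_symmetric X}).

(* Retyped so that omega x is linear for the R-module structure of R^o. *)
Definition flat1 (x : X) : X -> R^o := omega x.

Fact flat1_linear x : linear (flat1 x).
Proof. by move=> a u w; rewrite /flat1 linearDr linearZr_LR. Qed.

HB.instance Definition _ x :=
  GRing.isLinear.Build R X R^o _ (flat1 x) (flat1_linear x).

Definition flat2 (x : X) : 'Hom(X, R^o) := linfun (flat1 x).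

Fact flat2_linear : linear flat2.
Proof.
move=> a u w; apply/lfunP => z.
by rewrite add_lfunE scale_lfunE !lfunE /= /flat1 linearDl linearZl_LR.
Qed.

HB.instance Definition _ :=
  GRing.isLinear.Build R X 'Hom(X, R^o) _ flat2 flat2_linear.

Definition flat : 'Hom(X, 'Hom(X, R^o)) := linfun flat2.

Lemma flatE x v : flat x v = omega x v.
Proof. by rewrite !lfunE. Qed.

(* The isomorphism X^* -> X with f = omega (sharp f); see sharpE, sharp_uniq. *)
Definition sharp : 'Hom('Hom(X, R^o), X) := (flat^-1)%VF.

(* lker0_lfunVK is stated for endomorphisms only, hence the dimension count. *)
Lemma sharpE (f : 'Hom(X, R^o)) v :
  is_psymplectic omega -> omega (sharp f) v = f v.
Proof.
case=> nd _ _; rewrite -flatE.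
have ker0 : lker flat == 0%VS.
  rewrite -subv0; apply/subvP => u; rewrite memv_ker => /eqP fu0.
  rewrite -(eqP nd); apply/mem_orthovP => w _.
  by rewrite -flatE fu0 lfunE.
suff fullE : limg flat = fullv by rewrite limg_lfunVK // fullE memvf.
apply/eqP; rewrite eqEdim subvf /= limg_dim_eq; last first.
  by rewrite (eqP ker0) capv0.
by rewrite !dimvf /dim /= /dim /= muln1.
Qed.

Lemma sharp_uniq (f : 'Hom(X, R^o)) x : is_psymplectic omega ->
  (forall v, f v = omega x v) -> x = sharp f.
Proof.
move=> sympl fE; apply/eqP; rewrite -subr_eq0 -memv0.
have [/eqP <- _ _] := sympl; apply/mem_orthovP => w _.
by rewrite linearBl /= sharpE // fE subrr.
Qed.

Definition dual_body (C : set X) : set X := sharp @` polar C.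

Definition dual_gauge (g : X -> R) : X -> R :=
  minkowski (dual_body (unit_ball g)).

End DualGauge.

(* Main.v *)
Require Import Defs.
From mathcomp Require Import all_boot all_order all_algebra sesquilinear.
From mathcomp Require Import boolp classical_sets reals.
From mathcomp Require Import ring lra topology normedtype derive.

Set Implicit Arguments.
Unset Strict Implicit.
Unset Printing Implicit Defensive.

Import Order.TTheory GRing.Theory Num.Theory.
Import numFieldNormedType.Exports.
Local Open Scope ring_scope.

(** Put [w = - y] and [c = omega y x = omega x w], so that [dual_gauge x] is the
    supremum of [omega x v] over the unit ball and
    [omega x v <= dual_gauge x * gamma v].  Since [omega x (w + t x) = c], the
    conclusion follows from [dual_gauge x * gamma w <= c].  A linear functional
    dominated by [gamma] and equal to it at [w] is [omega z] for some [z] in the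
    dual body; in dimension two [z] is a positive multiple [gamma w / c] of some
    point [x + tau y], hence orthogonality gives
    [dual_gauge x <= dual_gauge (x + tau y) <= c / gamma w]. *)

Section GaugeTheory.
Variables (R : realType) (X : vectType R) (g : X -> R).
Hypothesis gP : is_gauge g.

Lemma gauge_gt0 x : x != 0 -> 0 < g x.
Proof.
move=> x0; rewrite lt_neqAle gauge_ge0 // andbT eq_sym.
by apply: contraNneq x0 => /(gauge_eq0 gP) ->.
Qed.

Lemma gauge_scale_ge (t : R) w : t * g w <= g (t *: w).
Proof.
have [t0|t0] := leP 0 t; first by rewrite gaugeZ.
by rewrite (le_trans _ (gauge_ge0 gP _)) // mulr_le0_ge0 ?gauge_ge0 ?ltW.
Qed.

Lemma gauge_scale_le (t : R) w : g (t *: w) <= `|t| * (g w + g (- w)).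
Proof.
have gw := gauge_ge0 gP w; have gNw := gauge_ge0 gP (- w).
have [t0|t0] := leP 0 t.
  by rewrite gaugeZ // ger0_norm // ler_wpM2l // lerDl.
have Nt0 : 0 <= - t by rewrite oppr_ge0 ltW.
rewrite -[t *: w]opprK -scalerN -scaleNr gaugeZ //.
by rewrite ltr0_norm // ler_wpM2l // lerDr.
Qed.

(* Hahn-Banach extension of a norming functional from the line of [w]. *)
Lemma gauge_support x w :
  exists m : R, forall s t, s * m + t * g w <= g (s *: x + t *: w).
Proof.
(* After rescaling to [s = -1], the required inequality bounds [m] below by the elements of [E];
   rescaling to [s = 1] gives the upper bounds in [E_le]. The triangle inequality puts every lower
   bound under every upper one, so [sup E] meets both. *)
pose E := [set r : R | exists t, r = t * g w - g (t *: w - x)]%classic.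
have E_le r t' : E r -> r <= g (x + t' *: w) - t' * g w.
  case=> t ->; have := gaugeD gP (t *: w - x) (x + t' *: w).
  by rewrite addrA subrK -scalerDl; have := gauge_scale_ge (t + t') w; lra.
have E_ub : has_ubound E by exists (g (x + 0 *: w) - 0 * g w) => r /E_le.
have E_n0 : (E !=set0)%classic by exists (0 * g w - g (0 *: w - x)), 0.
exists (sup E) => s t; case: (ltgtP s 0) => [s0|s0|->].
- have Ns0 : 0 < - s by rewrite oppr_gt0.
  have /(ub_le_sup E_ub) : E (t / - s * g w - g ((t / - s) *: w - x)).
    by exists (t / - s).
  have -> : s *: x + t *: w = - s *: ((t / - s) *: w - x).
    rewrite scalerBr scalerA mulrCA mulfV ?mulr1 ?gt_eqF //.
    by rewrite scaleNr opprK addrC.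
  rewrite (gaugeZ gP _ (ltW Ns0)) -(ler_pM2l Ns0) mulrBr mulrA.
  by rewrite [- s * (t / - s)]mulrCA mulfV ?mulr1 ?gt_eqF //; lra.
- have : sup E <= g (x + (t / s) *: w) - t / s * g w.
    by apply: ge_sup => // r /E_le.
  have -> : s *: x + t *: w = s *: (x + (t / s) *: w).
    by rewrite scalerDr scalerA mulrCA mulfV ?mulr1 ?gt_eqF.
  rewrite (gaugeZ gP _ (ltW s0)) -(ler_pM2l s0) mulrBr mulrA.
  by rewrite [s * (t / s)]mulrCA mulfV ?mulr1 ?gt_eqF //; lra.
- by rewrite mul0r add0r scale0r add0r gauge_scale_ge.
Qed.

Lemma gauge_line_continuous w x : continuous (fun s : R => g (w + s *: x)).
Proof.
(* A Lipschitz constant along the line; the summand 1 keeps it positive even when [x] is zero. *)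
pose M := g x + g (- x) + 1.
have M0 : 0 < M by rewrite ltr_wpDl // addr_ge0 ?gauge_ge0.
have lip s s' : g (w + s' *: x) - g (w + s *: x) <= `|s' - s| * M.
  have := gaugeD gP (w + s *: x) ((s' - s) *: x).
  rewrite -addrA -scalerDl subrKC => H.
  have := gauge_scale_le (s' - s) x.
  by have := normr_ge0 (s' - s); rewrite /M; lra.
move=> s; apply/cvgrPdist_le => e e0; near=> s'.
have : `|s - s'| * M <= e.
  rewrite -ler_pdivlMr //; near: s'.
  by apply: cvgr_dist_le => //; rewrite divr_gt0.
apply: le_trans; rewrite ler_norml lip andbT.
by have := lip s s'; rewrite distrC; lra.
Unshelve. all: by end_near. Qed.

(** By the triangle inequality [g (s *: x) - g (- w)] bounds the gauge below on the line, and [A],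
    [B] are chosen so that this is at least 1 outside [[- A, B]]. On that compact interval the
    minimum is attained at a nonzero vector. *)
Lemma gauge_line_min w x : (forall s : R, w + s *: x != 0) -> x != 0 ->
  exists2 e : R, 0 < e & forall s, e <= g (w + s *: x).
Proof.
move=> wx0 x0.
have gx : 0 < g x by rewrite gauge_gt0.
have gNx : 0 < g (- x) by rewrite gauge_gt0 ?oppr_eq0.
pose B := (1 + g (- w)) / g x; pose A := (1 + g (- w)) / g (- x).
have gw1 : 0 <= 1 + g (- w) by rewrite addr_ge0 ?gauge_ge0.
have A0 : 0 <= A by rewrite divr_ge0 // ltW.
have B0 : 0 <= B by rewrite divr_ge0 // ltW.
have /EVT_min : - A <= B by lra.
move=> /(_ (fun s => g (w + s *: x)))[|c _ cmin].
  by apply: continuous_subspaceT; exact: gauge_line_continuous.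
exists (Num.min 1 (g (w + c *: x))).
  by rewrite lt_min ltr01 gauge_gt0.
move=> s; rewrite ge_min; apply/orP.
have := gaugeD gP (w + s *: x) (- w); rewrite addrC addKr => gs.
have [sA|sA] := ltP s (- A).
  left; have : A * g (- x) <= - s * g (- x) by rewrite ler_pM2r; lra.
  rewrite divfK ?gt_eqF //.
  by rewrite -(gaugeZ gP) ?scalerN ?scaleNr ?opprK; lra.
have [sB|sB] := ltP B s; last first.
  by right; apply: cmin; rewrite in_itv /= sA sB.
left; have : B * g x <= s * g x by rewrite ler_pM2r // ltW.
by rewrite divfK ?gt_eqF // -(gaugeZ gP); lra.
Qed.

End GaugeTheory.

Section DualGaugeTheory.
Variables (R : realType) (X : vectType R) (omega : {skew_symmetric X}).
Hypothesis sympl : is_psymplectic omega.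

Lemma sympl_skew u v : omega u v = - omega v u.
Proof. by rewrite hermC /= expr1 mulN1r. Qed.

Lemma sympl_self u : omega u u = 0.
Proof. by have := sympl_skew u u; lra. Qed.

Lemma sympl_expand a b s t x y :
  omega (a *: x + b *: y) (s *: x + t *: y) = (b * s - a * t) * omega y x.
Proof.
rewrite linearDl !linearZl_LR /=.
have lin z : omega z (s *: x + t *: y) = s * omega z x + t * omega z y.
  by rewrite linearDr !linearZr_LR.
by rewrite !lin !sympl_self (sympl_skew x y); ring.
Qed.

Lemma dual_bodyE (C : set X) z :
  dual_body omega C z <-> forall v, C v -> omega z v <= 1.
Proof.
split=> [[f fC <-] v Cv|zC]; first by rewrite sharpE //; exact: fC.
exists (flat omega z); last first.
  by apply/esym/sharp_uniq => // v; rewrite flatE.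
by move=> v Cv; rewrite flatE; exact: zC.
Qed.

Section Gauge.
Variable g : X -> R.
Hypothesis gP : is_gauge g.

(** Homogeneity turns a bound on the unit ball into one on all vectors: normalise [v] by its gauge,
    and divide [z] by [l]. *)
Lemma scaled_dual_bodyE (l : R) z : 0 < l ->
  ( *:%R l @` dual_body omega (unit_ball g))%classic z <->
  forall v, omega z v <= l * g v.
Proof.
move=> l0; split=> [[k /dual_bodyE kP <-] v|zl].
  have [->|v0] := eqVneq v 0.
    by rewrite linear0r mulr_ge0 ?gauge_ge0 ?ltW.
  have gv := gauge_gt0 gP v0.
  rewrite linearZl_LR /= ler_pM2l //.
  have gvV : 0 <= (g v)^-1 by rewrite invr_ge0 ltW.
  have := kP ((g v)^-1 *: v); rewrite /unit_ball /= (gaugeZ gP _ gvV).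
  rewrite mulVf ?gt_eqF // lexx linearZr_LR /= => /(_ isT).
  by rewrite mulrC ler_pdivrMr // mul1r.
exists (l^-1 *: z); last by rewrite scalerA mulfV ?scale1r ?gt_eqF.
apply/dual_bodyE => v gv; rewrite linearZl_LR /= mulrC ler_pdivrMr // mul1r.
by rewrite (le_trans (zl v)) // -[leRHS]mulr1 ler_pM2l.
Qed.

Lemma dual_gauge_le (l : R) z : 0 < l ->
  (forall v, omega z v <= l * g v) -> dual_gauge omega g z <= l.
Proof.
move=> l0 zl; apply: ge_inf; first by exists 0 => r [].
by split; [exact: ltW | apply/scaled_dual_bodyE].
Qed.

(** The bound by [l] makes the set under the infimum nonempty, so that the infimum is not the
    default value 0. *)
Lemma dual_gauge_pairing (l : R) z v : 0 < l ->
  (forall v', omega z v' <= l * g v') -> omega z v <= dual_gauge omega g z * g v.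
Proof.
move=> l0 zl; have [->|v0] := eqVneq v 0.
  by have [_ /(_ erefl) ->] := gauge_eq0 gP 0; rewrite linear0r mulr0.
rewrite -ler_pdivrMr ?gauge_gt0 //; apply: lb_le_inf.
  by exists l; split; [exact: ltW | apply/scaled_dual_bodyE].
move=> r [r0 rz]; rewrite ler_pdivrMr ?gauge_gt0 //.
(* Scaling by 0 collapses the dual body to the origin, so [z] vanishes. *)
have [r_eq0|r_neq0] := eqVneq r 0.
  case: rz => k _; rewrite r_eq0 scale0r => <-.
  by rewrite linear0l mul0r.
by apply: (scaled_dual_bodyE _ _).1; rewrite // lt_neqAle eq_sym r_neq0.
Qed.

End Gauge.

Hypothesis dimX : \dim {: X} = 2%N.

Lemma sympl_coord x y v : omega y x != 0 -> exists s t : R, v = s *: x + t *: y.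
Proof.
move=> yx0.
have y0 : y != 0 by apply: contraNneq yx0 => ->; rewrite linear0l.
have xy_free : free [:: x; y].
  rewrite free_cons seq1_free y0 andbT span_seq1.
  apply: contra yx0 => /vlineP[k ->].
  by rewrite linearZr_LR /= sympl_self mulr0.
have /andP[/eqP spanE _] : basis_of fullv [:: x; y].
  by rewrite basisEfree xy_free subvf dimX.
have : v \in <<[:: x; y]>>%VS by rewrite spanE memvf.
rewrite span_cons span_seq1 => /memv_addP[_ /vlineP[s ->]].
by case=> _ /vlineP[t ->] ->; exists s, t.
Qed.

(** This supplies the finite bound required by [dual_gauge_pairing]. Only vectors with negative
    [y]-coordinate pair positively with [x]; each is a positive multiple of a point on the line
    through [- y] directed by [x], where the pairing is [c] and the gauge at least [e]. *)
Lemma sympl_bounded g x y : is_gauge g -> 0 < omega y x ->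
  exists2 l : R, 0 < l & forall v, omega x v <= l * g v.
Proof.
move=> gP c0; set c := omega y x in c0.
have yx0 : omega y x != 0 by rewrite gt_eqF.
have x0 : x != 0 by apply: contraNneq yx0 => ->; rewrite linear0r.
have [s|e e0 emin] := gauge_line_min gP (w := - y) _ x0.
  (* The line misses the origin, since each of its points pairs with [x] to [- c]. *)
  apply: contraNneq yx0 => yE; have : omega (- y + s *: x) x = 0.
    by rewrite yE linear0l.
  by rewrite linearDl linearNl linearZl_LR /= sympl_self mulr0 addr0; lra.
exists (c / e) => [|v]; first by rewrite divr_gt0.
have [s [t ->]] := sympl_coord v yx0.
rewrite linearDr !linearZr_LR /= sympl_self mulr0 add0r sympl_skew -/c.
have [t0|t0] := leP 0 t.
  have ce : 0 < c / e by rewrite divr_gt0.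
  apply: (@le_trans _ _ 0); last by rewrite mulr_ge0 ?(ltW ce) ?(gauge_ge0 gP).
  by rewrite mulrN oppr_le0 mulr_ge0 ?(ltW c0).
have Nt0 : 0 < - t by rewrite oppr_gt0.
have -> : s *: x + t *: y = - t *: (- y + (s / - t) *: x).
  rewrite scalerDr scalerA mulrCA mulfV ?mulr1 ?gt_eqF //.
  by rewrite scalerN scaleNr opprK addrC.
rewrite (gaugeZ gP _ (ltW Nt0)) mulrN -mulNr mulrCA ler_pM2l //.
by rewrite mulrAC -mulrA -[leLHS]mulr1 ler_pM2l // ler_pdivlMr ?mul1r.
Qed.

End DualGaugeTheory.

Theorem theorem5p1 (R : realType) (X : vectType R) (dimX : \dim {: X} = 2%N)
    (gamma : X -> R) (gamma_gauge : is_gauge gamma)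
    (omega : {skew_symmetric X}) (omega_sympl : is_psymplectic omega)
    (x y : X) (omega_gt0 : 0 < omega y x) :
  orthogonal_to (dual_gauge omega gamma) x y -> orthogonal_to gamma (- y) x.
Proof.
move=> xy t; set c := omega y x in omega_gt0.
have yx0 : omega y x != 0 by rewrite gt_eqF.
have gNy : 0 < gamma (- y).
  apply: gauge_gt0 => //; rewrite oppr_eq0.
  by apply: contraNneq yx0 => ->; rewrite linear0l.
have [l l0 xl] := sympl_bounded dimX gamma_gauge omega_gt0.
have cle : c <= dual_gauge omega gamma x * gamma (- y + t *: x).
  have := dual_gauge_pairing omega_sympl gamma_gauge (- y + t *: x) l0 xl.
  rewrite linearDr linearNr linearZr_LR /= sympl_self mulr0 addr0.
  by rewrite sympl_skew opprK.
have [m mP] := gauge_support gamma_gauge x (- y).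
have dual_le : dual_gauge omega gamma x <= c / gamma (- y).
  (* With [tau = m / gamma (- y)], the functional of [x + tau *: y] is [c / gamma (- y)] times the
     supporting one, which sends [x] to [m] and [- y] to [gamma (- y)]. *)
  apply: le_trans (xy (m / gamma (- y))) _.
  apply: dual_gauge_le => // [|v]; first by rewrite divr_gt0.
  have [s [r ->]] := sympl_coord dimX v yx0.
  have := mP s (- r); rewrite scalerN scaleNr opprK => vP.
  rewrite mulrAC ler_pdivlMr //.
  rewrite -{1}[x]scale1r sympl_expand -/c.
  rewrite [leLHS](_ : _ = c * (s * m + - r * gamma (- y))) ?ler_pM2l //.
  by field; rewrite gt_eqF.
move: dual_le; rewrite ler_pdivlMr // => /le_trans /(_ cle).
(* Cancelling the dual gauge of [x] requires it to be positive; otherwise [cle] would contradict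
   [0 < c]. *)
have [x0|x0] := ltP 0 (dual_gauge omega gamma x); first by rewrite ler_pM2l.
have : dual_gauge omega gamma x * gamma (- y + t *: x) <= 0.
  by rewrite mulr_le0_ge0 ?gauge_ge0.
by lra.
Qed.
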